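(* For every $w\in S_n$, the Schubert varieties $\mathcal{X}_w$ and $\mathcal{X}_{w^{-1}}$ have the same tangent cone at the standard flag: $\mathcal{T}_w=\mathcal{T}_{w^{-1}}$.
   Context: $\mathcal{F}$ is the variety of complete flags $V_0\subset V_1\subset\cdots\subset V_n=\mathbb{C}^n$, $\dim V_k=k$; $\varepsilon_1,\dots,\varepsilon_n$ is the standard basis, $F_0$ the standard flag $V_k=\langle\varepsilon_1,\dots,\varepsilon_k\rangle$, $B$ the group of upper-triangular matrices in $\mathrm{GL}(n,\mathbb{C})$. For $w\in S_n$, $\mathcal{X}_w$ is the closure of the $B$-orbit of the flag $V_k=\langle\varepsilon_{w(1)},\dots,\varepsilon_{w(k)}\rangle$; it contains $F_0$. Near $F_0$, flags are in bijection with lower unitriangular $n\times n$ matrices $X=(x_{ij})$ ($V_k$ is the span of the first $k$ columns of $X$), so the $x_{ij}$, $i>j$, are local coordinates centred at $F_0$ and coordinates on $T_{F_0}\mathcal{F}$. The tangent cone $\mathcal{T}_w\subset T_{F_0}\mathcal{F}$ is the set of vectors tangent to $\mathcal{X}_w$ at $F_0$, i.e. the common zero set of the lowest-degree homogeneous parts of the polynomials in the $x_{ij}$ vanishing on $\mathcal{X}_w$ in this chart. *)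

(* Defs.v *)
From HB Require Import structures.
From mathcomp Require Import all_boot all_order all_algebra all_fingroup.
From mathcomp Require Import mpoly.
From mathcomp Require Import complex.
From mathcomp Require Import classical_sets reals.

Set Implicit Arguments.
Unset Strict Implicit.
Unset Printing Implicit Defensive.

Import GRing.Theory.
Local Open Scope ring_scope.
Local Open Scope classical_set_scope.

Section Polynomials.
Variable C : fieldType.

(* Polynomials in variables indexed by an arbitrary finite type [I]; the
   variable attached to [i : I] is ['X_(enum_rank i)]. *)
Definition fpoly (I : finType) := {mpoly C[#|I|]}.

Definition feval (I : finType) (p : fpoly I) (v : {ffun I -> C}) : C :=
  p.@[fun k => v (enum_val k)].

(* The least degree of a monomial of [p] (the default value [msize p] is only
   reached for [p = 0]), and the homogeneous part of [p] in that degree. *)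
Definition lowdeg (I : finType) (p : fpoly I) : nat :=
  \big[minn/msize p]_(m <- msupp p) mdeg m.

Definition lowpart (I : finType) (p : fpoly I) : fpoly I :=
  pihomog mdeg (lowdeg p) p.

End Polynomials.

Section Flags.
Variables (C : fieldType) (n : nat).

Definition is_flag (V : {ffun 'I_n.+1 -> {vspace 'cV[C]_n}}) : bool :=
  [forall k, \dim (V k) == k]
  && [forall j : 'I_n.+1, forall k : 'I_n.+1, (j <= k)%N ==> (V j <= V k)%VS].

(* The conditions V_0 = 0 and V_n = C^n follow from the dimensions. *)
Record flag := Flag {
  flag_space :> {ffun 'I_n.+1 -> {vspace 'cV[C]_n}};
  flagP : is_flag flag_space }.

Definition span_flag_space (e : n.-tuple 'cV[C]_n) :
    {ffun 'I_n.+1 -> {vspace 'cV[C]_n}} :=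
  [ffun k : 'I_n.+1 => <<take k e>>%VS].

Lemma span_is_flag (e : n.-tuple 'cV[C]_n) :
  free e -> is_flag (span_flag_space e).
Proof.
move=> fe; apply/andP; split.
  apply/forallP => k; rewrite ffunE.
  have := fe; rewrite -{1}(cat_take_drop k e) => /catl_free.
  rewrite /free => /eqP ->; rewrite size_take size_tuple.
  by have := ltn_ord k; rewrite ltnS; case: ltngtP => // ->.
apply/forallP => j; apply/forallP => k; apply/implyP => le_jk.
rewrite !ffunE; apply: sub_span => x.
by rewrite -(subnKC le_jk) takeD mem_cat => ->.
Qed.

Definition span_flag (e : n.-tuple 'cV[C]_n) (fe : free e) : flag :=
  Flag (span_is_flag fe).

Definition cols (g : 'M[C]_n) : n.-tuple 'cV[C]_n :=
  [tuple col j g | j < n].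

Lemma cols_free (g : 'M[C]_n) : g \in unitmx -> free (cols g).
Proof.
move=> gU; apply/freeP => c c0 i.
have : g *m (\col_j c j) = 0.
  rewrite -[RHS]c0; apply/colP => r; rewrite summxE !mxE.
  by apply: eq_bigr => j _; rewrite !mxE (nth_mktuple _ _ j) mxE mulrC.
move/(congr1 (mulmx (invmx g))); rewrite mulKmx // mulmx0 => /colP/(_ i).
by rewrite !mxE.
Qed.

Definition mx_flag (g : 'M[C]_n) (gU : g \in unitmx) : flag :=
  span_flag (cols_free gU).

(* The flag V_k = <eps_(w 1), ..., eps_(w k)>; column j of the matrix below is
   eps_(w j). *)
Definition perm_basis_mx (w : 'S_n) : 'M[C]_n := \matrix_(i, j) (i == w j)%:R.

Lemma perm_basis_mx_unit (w : 'S_n) : perm_basis_mx w \in unitmx.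
Proof.
suff -> : perm_basis_mx w = perm_mx (w^-1)%g by exact: unitmx_perm.
by apply/matrixP => i j; rewrite !mxE -[in RHS](inj_eq (@perm_inj _ w)) permKV.
Qed.

Definition perm_flag (w : 'S_n) : flag := mx_flag (perm_basis_mx_unit w).

Definition borel : set 'M[C]_n :=
  [set b | b \in unitmx /\ forall i j : 'I_n, (j < i)%N -> b i j = 0].

Definition borel_orbit (V : flag) : set flag :=
  [set V' : flag | exists2 b, borel b &
     forall k, V' k = (linfun (mulmx b : 'cV[C]_n -> 'cV[C]_n) @: V k)%VS].

Definition mx_coords (g : 'M[C]_n) : {ffun 'I_n * 'I_n -> C} :=
  [ffun ij => g ij.1 ij.2].

(* The Zariski topology on the flag variety, seen as the quotient GL(n)/B via
   g |-> (spans of the first k columns of g): a set of flags is closed iff its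
   preimage in GL(n) is the zero locus in GL(n) of a set of polynomials in the
   matrix entries. (The factor 1/det is invertible on GL(n), so that using
   the coordinate ring C[g_ij, 1/det] would give the same closed sets.) *)
Definition flag_closed (Z : set flag) : Prop :=
  exists P : set (fpoly C ('I_n * 'I_n)%type),
    forall (g : 'M[C]_n) (gU : g \in unitmx),
      Z (mx_flag gU) <-> forall p, P p -> feval p (mx_coords g) = 0.

Definition schubert (w : 'S_n) : set flag :=
  smallest flag_closed (borel_orbit (perm_flag w)).

(* Index set of the coordinates x_ij, i > j. *)
Definition lowidx := {ij : 'I_n * 'I_n | (ij.2 < ij.1)%N}.

Definition unitri_mx (x : {ffun lowidx -> C}) : 'M[C]_n :=
  \matrix_(i, j) if (insub (i, j) : option lowidx) is Some a then x a else (i == j)%:R.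

Lemma unitri_mx_unit (x : {ffun lowidx -> C}) : unitri_mx x \in unitmx.
Proof.
rewrite unitmxE det_trig.
  rewrite big1 ?unitr1 // => i _; rewrite mxE insubF /= ?eqxx //.
  by rewrite ltnn.
apply/is_trig_mxP => i j lt_ij; rewrite mxE insubF /=; last first.
  by rewrite ltnNge ltnW.
by case: eqP lt_ij => // ->; rewrite ltnn.
Qed.

(* The chart around the standard flag, which is the image of x = 0. *)
Definition chart (x : {ffun lowidx -> C}) : flag := mx_flag (unitri_mx_unit x).

Definition schubert_chart (w : 'S_n) : set {ffun lowidx -> C} :=
  [set x | schubert w (chart x)].

(* The tangent space to the flag variety at the standard flag is identified
   with the space of coordinate vectors. *)
Definition tangent_cone (w : 'S_n) : set {ffun lowidx -> C} :=
  [set v | forall p : fpoly C lowidx,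
     (forall x, schubert_chart w x -> feval p x = 0) -> feval (lowpart p) v = 0].

End Flags.

Arguments schubert C [n] w.
Arguments tangent_cone C [n] w.

(* Main.v *)
Require Import Defs.
From mathcomp Require Import all_boot all_order all_algebra all_fingroup.
From mathcomp Require Import mpoly.
From mathcomp Require Import complex classical_sets reals.

(** Matrix inversion explains the equality. In GL(n) the double cosets
    satisfy (B w B)^-1 = B w^-1 B, so inversion exchanges their Zariski
    closures. These closures are the preimages of X_w and X_(w^-1) under
    the quotient map g |-> g B ([schubertP]). Inversion also preserves the
    group of lower unitriangular matrices, which is the chart around F_0;
    hence in this chart it is a polynomial involution carrying X_w onto
    X_(w^-1) ([schubert_chart_inv]). Its expansion at the centre is
    (1 + N)^-1 = 1 - N + N^2 - ..., so its linear part is - id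
    ([inv_coord_init]).

    Substituting such a map into a polynomial p multiplies the lowest
    homogeneous part of p by the sign (-1)^d, d being its degree
    ([lowpart_fsubst]), and so leaves the zero set of that part unchanged.
    If p vanishes on X_(w^-1), then p composed with inversion vanishes on
    X_w, and both have the same zeros of the lowest part. This gives
    T_w <= T_(w^-1), and the other inclusion follows on exchanging w and
    w^-1.

    To remain within polynomials in the entries, inversion on GL(n) is
    replaced by the adjugate h |-> det(h) h^-1: the scalar det(h) is
    absorbed by B, and it equals 1 on unitriangular matrices. *)

Set Implicit Arguments.
Unset Strict Implicit.
Unset Printing Implicit Defensive.

Import GRing.Theory.
Local Open Scope ring_scope.
Local Open Scope classical_set_scope.

(** * Order of vanishing at the origin and lowest homogeneous parts *)

Section LowestPart.
Variable C : fieldType.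

Definition fsubst (I J : finType) (s : I -> fpoly C J) (p : fpoly C I) :
    fpoly C J :=
  p \mPo [tuple s (enum_val k) | k < #|I|].

Lemma feval_fsubst (I J : finType) (s : I -> fpoly C J) (p : fpoly C I) v :
  feval (fsubst s p) v = feval p [ffun i => feval (s i) v].
Proof.
rewrite /feval comp_mpoly_meval; apply: meval_eq => k.
by rewrite tnth_mktuple ffunE.
Qed.

Definition ord_ge (n d : nat) (p : {mpoly C[n]}) : Prop :=
  forall m, (mdeg m < d)%N -> p@_m = 0.

Lemma ord_geW n d e (p : {mpoly C[n]}) : (d <= e)%N -> ord_ge e p -> ord_ge d p.
Proof. by move=> le_de pe m lt_md; apply/pe/(leq_trans lt_md). Qed.

Lemma ord_ge0 n d : ord_ge d (0 : {mpoly C[n]}).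
Proof. by move=> m _; rewrite mcoeff0. Qed.

Lemma ord_geD n d (p q : {mpoly C[n]}) :
  ord_ge d p -> ord_ge d q -> ord_ge d (p + q).
Proof. by move=> pd qd m md; rewrite mcoeffD pd ?qd ?addr0. Qed.

Lemma ord_geZ n d c (p : {mpoly C[n]}) : ord_ge d p -> ord_ge d (c *: p).
Proof. by move=> pd m md; rewrite mcoeffZ pd ?mulr0. Qed.

Lemma ord_geM n d e (p q : {mpoly C[n]}) :
  ord_ge d p -> ord_ge e q -> ord_ge (d + e) (p * q).
Proof.
move=> pd qe m lt_m; apply/eqP; apply: contraTT lt_m => nz.
have /msuppM_le/allpairsP[[m1 m2] /= [m1p m2q ->]] : m \in msupp (p * q).
  by rewrite mcoeff_msupp.
rewrite mcoeff_msupp in m1p; rewrite mcoeff_msupp in m2q.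
rewrite mdegD -leqNgt leq_add // leqNgt.
  by apply: contraNN m1p => /pd ->.
by apply: contraNN m2q => /qe ->.
Qed.

Lemma ord_ge_sum n d (T : Type) (r : seq T) (P : pred T)
    (F : T -> {mpoly C[n]}) :
  (forall i, P i -> ord_ge d (F i)) -> ord_ge d (\sum_(i <- r | P i) F i).
Proof.
by move=> Fd; apply: big_ind => //; [exact: ord_ge0 | exact: ord_geD].
Qed.

Lemma ord_geX n (m : 'X_{1..n}) : ord_ge (mdeg m) ('X_[m] : {mpoly C[n]}).
Proof. by move=> m'; rewrite mcoeffX; case: eqP => // <-; rewrite ltnn. Qed.

(** Here [f0] is meant to be homogeneous of degree [d]: it is then the part of
    degree [d] of [f], and [f] has nothing below. Allowing [f0] to be zero
    makes the relation multiplicative without nonvanishing conditions. *)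
Definition same_init (n d : nat) (f f0 : {mpoly C[n]}) : Prop :=
  ord_ge d f0 /\ ord_ge d.+1 (f - f0).

Lemma same_init_ord n d (f f0 : {mpoly C[n]}) : same_init d f f0 -> ord_ge d f.
Proof.
case=> f0d ff0; rewrite -[f](subrK f0); apply: ord_geD f0d.
exact: ord_geW ff0.
Qed.

Lemma same_initM n d e (f f0 g g0 : {mpoly C[n]}) :
  same_init d f f0 -> same_init e g g0 -> same_init (d + e) (f * g) (f0 * g0).
Proof.
move=> Hf Hg; have ge := same_init_ord Hg.
case: Hf Hg => [f0d ff0] [g0e gg0]; split; first exact: ord_geM.
(* each summand gains one order, from f - f0 or from g - g0 *)
have -> : f * g - f0 * g0 = (f - f0) * g + f0 * (g - g0).
  by rewrite mulrBl mulrBr addrA subrK.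
by apply: ord_geD; [rewrite -addSn | rewrite -addnS]; apply: ord_geM.
Qed.

Lemma same_init1 n : same_init 0 (1 : {mpoly C[n]}) 1.
Proof. by split=> [m //|]; rewrite subrr; apply: ord_ge0. Qed.

Lemma same_initXn n d k (f f0 : {mpoly C[n]}) :
  same_init d f f0 -> same_init (d * k) (f ^+ k) (f0 ^+ k).
Proof.
move=> Hf; elim: k => [|k IHk]; first by rewrite muln0; apply: same_init1.
by rewrite mulnS !exprS; apply: same_initM.
Qed.

Lemma same_init_prod n (I : finType) (d : I -> nat) (f f0 : I -> {mpoly C[n]}) :
  (forall i, same_init (d i) (f i) (f0 i)) ->
  same_init (\sum_i d i) (\prod_i f i) (\prod_i f0 i).
Proof.
move=> Hf; apply: (big_ind3 (fun d f f0 => same_init d f f0)) => //.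
  exact: same_init1.
by move=> *; apply: same_initM.
Qed.

Lemma lowdeg_le (I : finType) (p : fpoly C I) m :
  m \in msupp p -> (lowdeg p <= mdeg m)%N.
Proof.
rewrite /lowdeg; elim: (msupp p : seq _) (msize p) => // a s IHs x.
rewrite inE big_cons geq_min => /orP[/eqP-> | /IHs->]; rewrite ?leqnn //.
by rewrite orbT.
Qed.

Lemma ord_ge_lowdeg (I : finType) (p : fpoly C I) : ord_ge (lowdeg p) p.
Proof.
move=> m lt_m; apply/eqP; rewrite mcoeff_eq0.
by apply: contraTN lt_m => /lowdeg_le; rewrite -leqNgt.
Qed.

Lemma lowdegP (I : finType) (p : fpoly C I) : p != 0 ->
  exists2 m, m \in msupp p & mdeg m = lowdeg p.
Proof.
move=> nz; have /(_ (msupp p) (msize p)) H : forall (s : seq 'X_{1..#|I|}) x,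
    \big[minn/x]_(m <- s) mdeg m = x \/
    exists2 m, m \in s & mdeg m = \big[minn/x]_(m <- s) mdeg m.
  elim=> [|a s IHs] x; first by rewrite big_nil; left.
  rewrite big_cons; case: (leqP (mdeg a) (\big[minn/x]_(m <- s) mdeg m)) => _.
    by right; exists a; rewrite ?mem_head.
  by have [|[m ms]] := IHs x; [left | right; exists m; rewrite ?inE ?ms ?orbT].
(* the default value exceeds the degree of every monomial *)
case: H => // lowE; have mp := mlead_supp nz.
by have := lowdeg_le mp; rewrite /lowdeg lowE leqNgt msize_mdeg_lt.
Qed.

Lemma lowdeg_eq (I : finType) (p : fpoly C I) m :
  ord_ge (mdeg m) p -> m \in msupp p -> lowdeg p = mdeg m.
Proof.
move=> pd mp; apply/eqP; rewrite eqn_leq lowdeg_le //= leqNgt.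
have [|m' m'p <-] := @lowdegP _ p.
  by apply: contraTneq mp => ->; rewrite msupp0.
by apply: contraTN m'p => /pd p0; rewrite mcoeff_msupp p0 eqxx.
Qed.

Lemma mcoeff_pihomog n d (p : {mpoly C[n]}) m :
  (pihomog mdeg d p)@_m = if mdeg m == d then p@_m else 0.
Proof.
rewrite pihomogE raddf_sum /=.
under eq_bigr => m' _ do rewrite mcoeffZ mcoeffX.
have [mp|mp] := boolP (m \in msupp p); last first.
  rewrite big_seq_cond big1 => [|m' /andP[m'p _]].
    by rewrite (memN_msupp_eq0 mp) if_same.
  by case: eqP m'p mp => [-> ->|]; rewrite ?mulr0.
rewrite -big_filter; case: ifP => md; last first.
  rewrite big_seq big1 // => m'; rewrite mem_filter => /andP[m'd _].
  have [m'm|_] := eqVneq m' m; last by rewrite mulr0.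
  by rewrite m'm md in m'd.
rewrite (bigD1_seq m) /= ?mem_filter ?md ?filter_uniq ?msupp_uniq //.
by rewrite eqxx mulr1 big1 ?addr0 // => m' /negPf ->; rewrite mulr0.
Qed.

(** A substitution with linear part [c * id] sends each monomial of degree [k]
    to [c ^+ k] times itself plus terms of higher degree. The lowest part of
    [p] therefore gets multiplied by a power of [c], and as [c] is nonzero it
    stays the lowest one. *)
Lemma lowpart_fsubst (I : finType) (s : I -> fpoly C I) (c : C)
    (p : fpoly C I) : c != 0 ->
  (forall i, ord_ge 2 (s i - c *: 'X_(enum_rank i))) ->
  lowpart (fsubst s p) = c ^+ lowdeg p *: lowpart p.
Proof.
move=> nzc s2; have [->|nzp] := eqVneq p 0.
  by rewrite /fsubst comp_mpoly0 /lowpart !pihomog0 scaler0.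
set d := lowdeg p; set q := fsubst s p.
have mono m : same_init (mdeg m) (fsubst s 'X_[m]) (c ^+ mdeg m *: 'X_[m]).
  rewrite /fsubst comp_mpolyX mpolyXE_id mdegE.
  have -> : c ^+ (\sum_i m i) *: \prod_(i < #|I|) 'X_i ^+ m i =
      \prod_(i < #|I|) (c *: 'X_i) ^+ m i :> fpoly C I.
    under [RHS]eq_bigr => i _ do rewrite exprZn.
    by rewrite scaler_prod prodrXr.
  apply: same_init_prod => i; rewrite -[X in same_init X]mul1n tnth_mktuple.
  apply: same_initXn; split.
    by apply: ord_geZ; have := @ord_geX _ U_(i)%MM; rewrite mdeg1.
  by have := s2 (enum_val i); rewrite enum_valK.
pose D : fpoly C I := q - c ^+ d *: lowpart p.
have D_high : ord_ge d.+1 D.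
  rewrite /D /q /fsubst comp_mpolyEX /lowpart pihomogE scaler_sumr.
  rewrite [X in _ - X]big_mkcond -sumrB big_seq; apply: ord_ge_sum => m mp.
  have [md|/eqP ne_md] := eqP.
    rewrite scalerA mulrC -scalerA -scalerBr; apply: ord_geZ.
    by rewrite /d -md; case: (mono m).
  rewrite subr0; apply: ord_geZ; apply: ord_geW (same_init_ord (mono m)).
  by rewrite ltn_neqAle eq_sym ne_md lowdeg_le.
have qE m : (mdeg m <= d)%N -> q@_m = c ^+ d * (lowpart p)@_m.
  move=> le_md; rewrite -mcoeffZ; apply/eqP.
  by rewrite -subr_eq0 -mcoeffB D_high.
have [m0 m0p m0d] := lowdegP nzp.
have lowq : lowdeg q = d.
  rewrite -[d]m0d; apply: lowdeg_eq.
    move=> m; rewrite m0d => lt_md; rewrite qE ?(ltnW lt_md) //.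
    by rewrite mcoeff_pihomog ltn_eqF // mulr0.
  rewrite mcoeff_msupp qE ?m0d // mcoeff_pihomog m0d eqxx.
  by rewrite mulf_neq0 ?expf_neq0 // -mcoeff_msupp.
apply/mpolyP => m; rewrite mcoeffZ /lowpart lowq !mcoeff_pihomog.
case: eqP => md; last by rewrite mulr0.
by rewrite qE ?md // mcoeff_pihomog md eqxx.
Qed.
End LowestPart.

(** * Flags as cosets of the Borel group, and Schubert varieties in GL(n) *)

Section Flags.
Variables (C : fieldType) (n : nat).
Implicit Types (g h b : 'M[C]_n) (w : 'S_n).

Lemma col_mul m p q (A : 'M[C]_(m, p)) (B : 'M_(p, q)) j :
  col j (A *m B) = A *m col j B.
Proof. by rewrite !colE mulmxA. Qed.

Lemma invmx_uniq g h : g *m h = 1%:M -> invmx g = h.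
Proof.
move=> gh1; have [gU _] := mulmx1_unit gh1.
by rewrite -[h](mulKmx gU) gh1 mulmx1.
Qed.

(** Multiplication by [g^-1] straightens the flag of [g] to the standard one,
    whose spaces are cut out by vanishing coordinates; equality of flags thus
    becomes a statement on matrix entries. *)
Lemma mem_span_cols g (u : 'cV[C]_n) (k : nat) : g \in unitmx ->
  (g *m u \in <<take k (cols g)>>%VS) <->
  (forall i : 'I_n, (k <= i)%N -> u i 0 = 0).
Proof.
move=> gU; split=> [gu i le_ki|u0].
  pose f := linfun (mulmx (row i (invmx g)) : 'cV[C]_n -> 'cV[C]_1).
  have /subvP/(_ _ gu) : (<<take k (cols g)>> <= lker f)%VS.
    apply/span_subvP => _ /(nthP 0)[j lt_j <-]; rewrite memv_ker lfunE /=.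
    move: lt_j; rewrite size_take_min size_tuple leq_min => /andP[lt_jk lt_jn].
    rewrite nth_take // (nth_mktuple _ _ (Ordinal lt_jn)) -row_mul -col_mul.
    rewrite mulVmx //; apply/eqP/colP => r; rewrite !mxE /= -val_eqE /=.
    by rewrite gtn_eqF // (leq_trans lt_jk).
  rewrite memv_ker lfunE /= -row_mul mulKmx // => /eqP/colP/(_ 0).
  by rewrite !mxE.
have -> : g *m u = \sum_j u j 0 *: col j g.
  apply/colP => r; rewrite summxE mxE; apply: eq_bigr => j _.
  by rewrite !mxE mulrC.
apply: memv_suml => j _; have [le_kj|lt_jk] := leqP k j.
  by rewrite u0 // scale0r mem0v.
apply/memvZ/memv_span/(nthP 0); exists j.
  by rewrite size_take_min size_tuple leq_min lt_jk ltn_ord.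
by rewrite nth_take // nth_mktuple.
Qed.

Lemma mx_flag_spans g h (gU : g \in unitmx) (hU : h \in unitmx) :
  (forall k, mx_flag gU k = mx_flag hU k) <->
  (forall k : nat, <<take k (cols g)>>%VS = <<take k (cols h)>>%VS).
Proof.
split=> gh k; last by rewrite !ffunE.
have [lt_k|le_nk] := ltnP k n.+1.
  by have := gh (Ordinal lt_k); rewrite !ffunE.
by have := gh ord_max; rewrite !ffunE !take_oversize ?size_tuple // ltnW.
Qed.

(** Two matrices give the same flag iff they lie in the same coset [g B]. This
    is what identifies flags with [GL(n) / B]. *)
Lemma mx_flag_eqP g h (gU : g \in unitmx) (hU : h \in unitmx) :
  (forall k, mx_flag gU k = mx_flag hU k) <-> borel (invmx g *m h).
Proof.
set b := invmx g *m h; have hE : h = g *m b by rewrite /b mulKVmx.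
split=> [/mx_flag_spans gh|[bU b_up]].
  split=> [|i j lt_ji]; first by rewrite unitmx_mul unitmx_inv gU.
  have: g *m col j b \in <<take j.+1 (cols g)>>%VS.
    rewrite gh -col_mul -hE; apply/memv_span/(nthP 0); exists j.
      by rewrite size_take_min size_tuple leq_min ltnSn ltn_ord.
    by rewrite nth_take // nth_mktuple.
  by move/(mem_span_cols _ _ gU)/(_ i lt_ji); rewrite mxE.
(* both spaces have dimension k, so one inclusion is enough *)
move=> k; apply/esym/eqP; rewrite eqEdim.
have dimF (V : flag C n) : \dim (V k) = k.
  by case/andP: (flagP V) => /forallP/(_ k)/eqP.
rewrite !dimF leqnn andbT !ffunE.
apply/span_subvP => _ /(nthP 0)[j lt_j <-].
move: lt_j; rewrite size_take_min size_tuple leq_min => /andP[lt_jk lt_jn].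
rewrite nth_take // (nth_mktuple _ _ (Ordinal lt_jn)) hE col_mul.
apply/(mem_span_cols _ _ gU) => i le_ki.
by rewrite mxE b_up // (leq_trans lt_jk).
Qed.

(** The matrices [1] and [b] give the same flag, and this relation is
    symmetric. *)
Lemma borelV b : borel b -> borel (invmx b).
Proof.
move=> bB; have [bU _] := bB.
have := @mx_flag_eqP 1%:M b (unitmx1 _ _) bU.
rewrite invmx1 mul1mx => -[_ /(_ bB) eq_b].
rewrite -[invmx b]mulmx1; apply/(mx_flag_eqP bU (unitmx1 _ _)) => k.
by rewrite eq_b.
Qed.

Lemma borelM b1 b2 : borel b1 -> borel b2 -> borel (b1 *m b2).
Proof.
case=> b1U b1_up [b2U b2_up]; split=> [|i j lt_ji].
  by rewrite unitmx_mul b1U.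
rewrite mxE big1 // => k _; have [lt_ki|le_ik] := ltnP k i.
  by rewrite b1_up ?mul0r.
by rewrite b2_up ?mulr0 // (leq_trans lt_ji).
Qed.

Lemma borelZ c b : c != 0 -> borel b -> borel (c *: b).
Proof.
move=> nzc [bU b_up]; split=> [|i j lt_ji]; last by rewrite mxE b_up ?mulr0.
by rewrite unitmxZ ?unitfE.
Qed.

Definition bruhat_cell w : set 'M[C]_n :=
  [set h | exists b1 b2,
    [/\ borel b1, borel b2 & h = b1 *m perm_basis_mx C w *m b2]].

Lemma bruhat_cell_unit w h : bruhat_cell w h -> h \in unitmx.
Proof.
case=> b1 [b2 [[b1U _] [b2U _] ->]].
by rewrite !unitmx_mul b1U b2U perm_basis_mx_unit.
Qed.

Lemma bruhat_cellMr w h b :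
  bruhat_cell w h -> borel b -> bruhat_cell w (h *m b).
Proof.
case=> b1 [b2 [b1B b2B ->]] bB; exists b1, (b2 *m b).
by split=> //; [exact: borelM | rewrite mulmxA].
Qed.

Lemma invmx_perm_basis w : invmx (perm_basis_mx C w) = perm_basis_mx C (w^-1)%g.
Proof.
apply/invmx_uniq/matrixP => i j.
rewrite !mxE (bigD1 (w^-1 j)%g) //= !mxE eqxx mulr1.
by rewrite permKV big1 ?addr0 // => k /negPf nk; rewrite !mxE nk mulr0.
Qed.

(** The inverse of [b1 w b2] is [b2^-1 w^-1 b1^-1], and the scalar relating the
    adjugate to the inverse is absorbed by the factor [b2^-1]. *)
Lemma bruhat_cell_adj w h : bruhat_cell w h -> bruhat_cell (w^-1)%g (\adj h).
Proof.
move=> hw; have hU := bruhat_cell_unit hw.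
have nz : \det h != 0 by rewrite -unitfE -unitmxE.
have -> : \adj h = \det h *: invmx h.
  by rewrite /invmx hU scalerA mulfV ?scale1r.
case: hw hU nz => b1 [b2 [b1B b2B hE]] hU nz.
have [[b1U _] [b2U _]] := (b1B, b2B).
exists (\det h *: invmx b2), (invmx b1); split; [|exact: borelV|].
  by apply: borelZ nz (borelV b2B).
rewrite -!scalemxAl; congr (_ *: _); rewrite hE -invmx_perm_basis.
have PU := perm_basis_mx_unit C w.
apply: invmx_uniq; rewrite -!mulmxA.
by rewrite (mulKVmx b2U) (mulKVmx PU) mulmxV.
Qed.

Lemma borel_orbitP w g (gU : g \in unitmx) :
  borel_orbit (perm_flag C w) (mx_flag gU) <-> bruhat_cell w g.
Proof.
have PU := perm_basis_mx_unit C w.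
have bP b : borel b -> b *m perm_basis_mx C w \in unitmx.
  by case=> bU _; rewrite unitmx_mul bU.
have img b (bB : borel b) k : mx_flag (bP b bB) k =
    (linfun (mulmx b : 'cV[C]_n -> 'cV[C]_n) @: perm_flag C w k)%VS.
  rewrite !ffunE limg_span map_take; congr <<take k _>>%VS.
  apply: (@eq_from_nth _ 0) => [|j]; rewrite !size_tuple // => lt_j.
  rewrite (nth_map 0) ?size_tuple // !(nth_mktuple _ _ (Ordinal lt_j)).
  by rewrite lfunE /= col_mul.
split=> [[b bB gE]|[b1 [b2 [b1B b2B gE]]]].
  have : forall k, mx_flag (bP b bB) k = mx_flag gU k.
    by move=> k; rewrite gE img.
  move/mx_flag_eqP => b2B; exists b, (invmx (b *m perm_basis_mx C w) *m g).
  by split=> //; rewrite mulKVmx ?bP.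
exists b1 => // k; rewrite -img; apply/esym; move: k.
by apply/mx_flag_eqP; rewrite gE mulKmx ?bP.
Qed.

Definition schubert_ideal w : set (fpoly C ('I_n * 'I_n)%type) :=
  [set p | forall h, bruhat_cell w h -> feval p (mx_coords h) = 0].

(** The zero locus in [GL(n)] of the ideal of [B w B] is stable under right
    multiplication by [B], because [B w B] is. It is thus the preimage of a
    closed set of flags, the smallest one containing the orbit. *)
Lemma schubertP w g (gU : g \in unitmx) :
  schubert C w (mx_flag gU) <->
  forall p, schubert_ideal w p -> feval p (mx_coords g) = 0.
Proof.
split=> [gS|gI Z [[P ZP] orbZ]]; last first.
  apply/ZP => p Pp; apply: gI => h hw.
  have hU := bruhat_cell_unit hw.
  by have /ZP := orbZ _ (iffRL (borel_orbitP w hU) hw); apply.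
(* ranging over all matrices h with flag V avoids choosing one *)
pose Z : set (flag C n) := [set V | forall h (hU : h \in unitmx),
  (forall k, mx_flag hU k = V k) ->
  forall p, schubert_ideal w p -> feval p (mx_coords h) = 0].
apply: (gS Z) => //; split; last first.
  move=> V [b bB VE] h hU hV p; apply; apply/(borel_orbitP w hU).
  by exists b => // k; rewrite hV.
exists (schubert_ideal w) => h hU; split=> [|hI h' h'U]; first exact.
rewrite /= => h'h p pI.
have /mx_flag_eqP bB : forall k, mx_flag hU k = mx_flag h'U k.
  by move=> k; rewrite h'h.
(* s is right multiplication by the element h^-1 h' of B *)
pose s (a : 'I_n * 'I_n) : fpoly C ('I_n * 'I_n)%type :=
  \sum_k (invmx h *m h') k a.2 *: 'X_(enum_rank (a.1, k)).
have sE f : feval (fsubst s p) (mx_coords f) =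
    feval p (mx_coords (f *m (invmx h *m h'))).
  rewrite feval_fsubst; congr feval; apply/ffunP => a; rewrite !ffunE mxE.
  rewrite /feval raddf_sum /=; apply: eq_bigr => k _.
  by rewrite mevalZ mevalXU enum_rankK ffunE mulrC.
rewrite -[h'](mulKVmx hU) -sE; apply: hI => f fw; rewrite sE.
by apply: pI; apply: bruhat_cellMr.
Qed.
End Flags.

(** * Inversion in the unitriangular chart *)

Section Chart.
Variables (C : fieldType) (n : nat).
Implicit Types w : 'S_n.

(** By induction on [i]: in row [i] of [L A = 1], the terms below the diagonal
    of [L] involve only rows [k < i <= j] of [A], whose entries in column [j]
    are already known to be zero. *)
Lemma unitri_inv (R : comNzRingType) (L A : 'M[R]_n) :
  (forall i j : 'I_n, (i <= j)%N -> L i j = (i == j)%:R) -> L *m A = 1%:M ->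
  forall i j : 'I_n, (i <= j)%N -> A i j = (i == j)%:R.
Proof.
move=> Ltri /matrixP LA i; have [m] := ubnP (i : nat).
elim: m i => // m IHm i le_im j le_ij.
have := LA i j; rewrite !mxE (bigD1 i) //= Ltri // eqxx mul1r.
rewrite big1 ?addr0 // => k ne_ki; have [lt_ki|le_ik] := ltnP k i.
  rewrite IHm ?(leq_trans lt_ki) ?(leq_trans (ltnW lt_ki)) //.
  by rewrite -val_eqE ltn_eqF ?mulr0 // (leq_trans lt_ki).
by rewrite Ltri // eq_sym (negPf ne_ki) mul0r.
Qed.

(** The generic point of the chart. *)
Definition gen_unitri : 'M[fpoly C (lowidx n)]_n :=
  \matrix_(i, j) if (insub (i, j) : option (lowidx n)) is Some a
                 then 'X_(enum_rank a) else (i == j)%:R.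

(** Inversion in the chart as a tuple of polynomials: the determinant is 1, so
    the adjugate is the inverse. *)
Definition inv_coord (a : lowidx n) : fpoly C (lowidx n) :=
  (\adj gen_unitri) (val a).1 (val a).2.

Lemma gen_unitri_tri (i j : 'I_n) :
  (i <= j)%N -> gen_unitri i j = (i == j)%:R.
Proof. by move=> le_ij; rewrite mxE insubF //= ltnNge le_ij. Qed.

Lemma gen_unitri_adj : gen_unitri *m \adj gen_unitri = 1%:M.
Proof.
rewrite mul_mx_adj det_trig; last first.
  apply/is_trig_mxP => i j lt_ij; rewrite (gen_unitri_tri (ltnW lt_ij)).
  have /negPf-> : i != j by rewrite -val_eqE ltn_eqF.
  exact: mulr0n.
rewrite big1 // => i _.
by rewrite (gen_unitri_tri (leqnn i)) eqxx mulr1n.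
Qed.

Lemma gen_unitri_low (a : lowidx n) :
  gen_unitri (val a).1 (val a).2 = 'X_(enum_rank a).
Proof. by rewrite mxE -surjective_pairing valK. Qed.

Lemma ord_ge1_gen (i j : 'I_n) : ord_ge 1 ((gen_unitri - 1%:M) i j).
Proof.
rewrite 4!mxE; case: insubP => [a lt_ji aE|] /=; last first.
  by rewrite subrr => _; apply: ord_ge0.
have -> : (i == j) = false by rewrite -val_eqE gtn_eqF.
by rewrite subr0 -(mdeg1 (enum_rank a)); apply: ord_geX.
Qed.

(** With [L = 1 + N] and [A] its inverse, applying [A = 1 - N A] twice gives
    [A = 1 - N + N N A]. The entries of [N] are coordinates or zero, so the
    remainder [N N A] has order at least 2. *)
Lemma inv_coord_init a : ord_ge 2 (inv_coord a - (-1) *: 'X_(enum_rank a)).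
Proof.
set A := \adj gen_unitri; set N := gen_unitri - 1%:M.
have AE : A = 1%:M - N + N *m (N *m A).
  have NA : N *m A = 1%:M - A by rewrite mulmxBl gen_unitri_adj mul1mx.
  by rewrite NA mulmxBr NA mulmx1 addrA subrK opprB addrC subrK.
have -> : inv_coord a - (-1) *: 'X_(enum_rank a) =
          (N *m (N *m A)) (val a).1 (val a).2.
  have ne : ((val a).1 == (val a).2) = false.
    by apply/negbTE; rewrite -val_eqE neq_ltn orbC (valP a).
  rewrite /inv_coord -/A {1}AE mxE; set T := (N *m _) _ _.
  rewrite [(_ - N) _ _]mxE [(- N) _ _]mxE /N [(gen_unitri - _) _ _]mxE.
  rewrite gen_unitri_low !mxE ne mulr0n oppr0 add0r addr0 scaleN1r opprK.
  by rewrite addrAC addNr add0r.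
rewrite mulmxA mxE; apply: ord_ge_sum => k _; rewrite -[2%N]addn0.
apply: ord_geM; last by move=> m.
rewrite mxE; apply: ord_ge_sum => l _.
by apply: (@ord_geM _ _ 1 1); apply: ord_ge1_gen.
Qed.

Definition inv_chart (x : {ffun lowidx n -> C}) : {ffun lowidx n -> C} :=
  [ffun a => feval (inv_coord a) x].

Lemma unitri_inv_chart x : unitri_mx (inv_chart x) = \adj (unitri_mx x).
Proof.
have -> : unitri_mx x = map_mx (meval (fun k => x (enum_val k))) gen_unitri.
  apply/matrixP => i j; rewrite !mxE; case: insubP => [a _ _|_].
    by rewrite mevalXU enum_rankK.
  by rewrite rmorph_nat.
rewrite -map_mx_adj; apply/matrixP => i j; rewrite [LHS]mxE [RHS]mxE.
case: insubP => [a _ aE|]; first by rewrite ffunE /inv_coord aE.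
rewrite -leqNgt => /= le_ij.
by rewrite (unitri_inv gen_unitri_tri gen_unitri_adj le_ij) rmorph_nat.
Qed.

(** If [p] vanishes on [B w^-1 B], then [h |-> p (adj h)] is a polynomial
    vanishing on [B w B]. *)
Lemma schubert_chart_inv w x :
  schubert_chart w x -> schubert_chart (w^-1)%g (inv_chart x).
Proof.
move=> /schubertP xS; apply/schubertP => p pI.
pose s (a : 'I_n * 'I_n) : fpoly C ('I_n * 'I_n)%type :=
  (\adj (\matrix_(i, j) 'X_(enum_rank (i, j)) : 'M_n)) a.1 a.2.
have sE f : feval (fsubst s p) (mx_coords f) = feval p (mx_coords (\adj f)).
  rewrite feval_fsubst; congr feval; apply/ffunP => a; rewrite !ffunE.
  pose v (k : 'I_#|{: 'I_n * 'I_n}|) : C := mx_coords f (enum_val k).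
  transitivity (map_mx (meval v)
      (\adj (\matrix_(i, j) 'X_(enum_rank (i, j)))) a.1 a.2).
    by rewrite [RHS]mxE.
  rewrite map_mx_adj; congr (\adj _ _ _); apply/matrixP => i j.
  rewrite !mxE; apply: etrans (mevalXU _ _) _.
  by rewrite /v enum_rankK ffunE.
rewrite unitri_inv_chart -sE; apply: xS => h hw; rewrite sE.
exact/pI/bruhat_cell_adj.
Qed.

Lemma tangent_cone_inv_sub w :
  tangent_cone C w `<=` tangent_cone C (w^-1)%g.
Proof.
move=> v vT p pS.
have /vT : forall x, schubert_chart w x -> feval (fsubst inv_coord p) x = 0.
  by move=> x /schubert_chart_inv /pS; rewrite feval_fsubst.
rewrite (lowpart_fsubst _ _ inv_coord_init) ?oppr_eq0 ?oner_eq0 //.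
rewrite /feval mevalZ => /eqP; rewrite mulf_eq0 expf_eq0 oppr_eq0 oner_eq0.
by rewrite andbF => /eqP.
Qed.
End Chart.

Theorem lemma5p4 (R : realType) (n : nat) (w : 'S_n) :
  tangent_cone R[i] w = tangent_cone R[i] (w^-1)%g.
Proof.
apply/seteqP; split; first exact: tangent_cone_inv_sub.
by move=> v /tangent_cone_inv_sub; rewrite invgK.
Qed.
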